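(* Let $h>0$, $a\in\mathbb{R}$, $\nu\in(0,1]$, $y:(h\mathbb{N})_a\to\mathbb{R}^n$, and let $P\in\mathbb{R}^{n\times n}$ be a constant, square, symmetric, and positive definite matrix. Then $$\tfrac12\,{}_a\Delta_{h}^{\nu}\big(y^{T}(t)Py(t)\big)\le y^{T}(t+\nu h)\,P\,({}_a\Delta_{h}^{\nu}y)(t),\qquad t\in(h\mathbb{N})_{a+(1-\nu)h}.$$
   Context: For $h>0$ and $a\in\mathbb{R}$, $(h\mathbb{N})_a=\{a,a+h,a+2h,\dots\}$, $\sigma(t)=t+h$, and $(\Delta_h y)(t)=\frac{y(t+h)-y(t)}{h}$. The $h$-factorial function is $t_h^{(\alpha)}=h^{\alpha}\frac{\Gamma(t/h+1)}{\Gamma(t/h+1-\alpha)}$, taken to be $0$ when $t/h+1-\alpha$ is a nonpositive integer and $t/h+1$ is not. For $\mu>0$ the fractional $h$-sum is $({}_a\Delta_h^{-\mu}y)(t)=\frac{h}{\Gamma(\mu)}\sum_{s=a/h}^{t/h-\mu}(t-\sigma(sh))_h^{(\mu-1)}y(sh)$ for $t\in(h\mathbb{N})_{a+\mu h}$, where $s$ runs over $a/h,a/h+1,\dots,t/h-\mu$ and $\sigma(sh)=(s+1)h$; and ${}_a\Delta_h^{0}y=y$. For $\nu\in(0,1]$ the Riemann–Liouville-like fractional $h$-difference is $({}_a\Delta_{h}^{\nu}y)(t)=(\Delta_h({}_a\Delta_h^{-(1-\nu)}y))(t)$, $t\in(h\mathbb{N})_{a+(1-\nu)h}$ (so it equals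 $\Delta_h y$ if $\nu=1$); it acts componentwise on vector-valued functions. The left-hand side is this operator applied to the scalar function $t\mapsto y^T(t)Py(t)$ and evaluated at $t$. *)

(* Defs.v *)
From mathcomp Require Import all_boot all_order all_algebra.
From mathcomp Require Import all_classical all_reals all_analysis.

Set Implicit Arguments.
Unset Strict Implicit.
Unset Printing Implicit Defensive.

Import Order.TTheory GRing.Theory Num.Theory.

Local Open Scope classical_set_scope.
Local Open Scope ring_scope.

Section FractionalHDifference.
Context {R : realType}.
Implicit Types (h a t x alpha mu nu : R).

(* Euler's integral if x > 0; otherwise extended by the functional equation
   Gamma x = Gamma (x + n) / (x (x + 1) ... (x + n - 1)), where n is the least
   natural number with x + n > 0.  At the poles 0, -1, -2, ... the product
   vanishes, and the value is 0 by the convention on division. *)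
Definition Gamma x : R :=
  let n := if 0 < x then 0%N else (Num.truncn (- x)).+1 in
  Rintegral lebesgue_measure `]0, +oo[
    (fun u => u `^ (x + n%:R - 1) * expR (- u))
  / \prod_(i < n) (x + i%:R).

Definition hN h a : set R := [set t | exists k : nat, t = a + k%:R * h].

Definition hsigma h t := t + h.

Definition hdiff h (y : R -> R) t := (y (t + h) - y t) / h.

Definition Gamma_pole x := - x \is a Num.nat.

Definition hfact h t alpha : R :=
  if Gamma_pole (t / h + 1 - alpha) && ~~ Gamma_pole (t / h + 1) then 0
  else h `^ alpha * (Gamma (t / h + 1) / Gamma (t / h + 1 - alpha)).

(* \sum_(s = p, p + 1, ..., q) F s with real bounds; [Num.truncn] sends
   negative numbers to 0, so the sum is empty when q < p. *)
Definition rsum (p q : R) (F : R -> R) : R :=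
  \sum_(k < Num.truncn (q - p + 1)) F (p + k%:R).

(* Functions on (hN)_a are represented by total functions, of which only the
   values on (hN)_a matter: s * h runs over (hN)_a in the sum. *)
Definition hsum h a mu (y : R -> R) t : R :=
  if mu == 0 then y t
  else h / Gamma mu *
       rsum (a / h) (t / h - mu)
         (fun s => hfact h (t - hsigma h (s * h)) (mu - 1) * y (s * h)).

Definition rldiff h a nu (y : R -> R) t : R :=
  hdiff h (hsum h a (1 - nu) y) t.

Definition rldiffv n h a nu (y : R -> 'cV[R]_n) t : 'cV[R]_n :=
  \col_i rldiff h a nu (fun s => y s i 0) t.

Definition posdefmx n (P : 'M[R]_n) :=
  forall x : 'cV[R]_n, x != 0 -> 0 < (x^T *m P *m x) 0 0.

End FractionalHDifference.

(* Main.v *)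
Require Import Defs.
From mathcomp Require Import all_boot all_order all_algebra.
From mathcomp Require Import all_classical all_reals all_analysis.
From mathcomp Require Import measurable_realfun.
From mathcomp Require Import ring lra.
Import Order.TTheory GRing.Theory Num.Theory.
Import numFieldNormedType.Exports.
Local Open Scope classical_set_scope.
Local Open Scope ring_scope.

(** The point t + nu h is the newest node Y = y (a + (k + 1) h) that enters the
difference at t = a + (1 - nu) h + k h.  Put mu = 1 - nu.  On its grid, the
fractional sum is a discrete convolution: its value at a + mu h + k h is
[\sum_(j <= k) w (k - j) * y (a + j h)] with
[w m = h ^ mu * Gamma (mu + m) / (Gamma mu * m!)] ([hsum_convolution]).
The equation Gamma (x + 1) = x Gamma x gives w (m + 1) / w m =
(mu + m) / (m + 1), which is at most 1 because mu <= 1; hence w is nonnegative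
and nonincreasing ([hsum_weightS_le]).  Subtracting consecutive sums, h times
the fractional difference is w 0 Y - \sum_j d_j y_j, where the
d_j = w (k - j) - w (k - j + 1) >= 0 telescope to w 0 - w (k + 1).

Writing q for the quadratic form of P, twice the gap between the two sides of
the inequality is, up to the factor 1 / h,
[\sum_j d_j q (Y - y_j) + w (k + 1) q (Y)], and every term is nonnegative
([quad_form_convolution_le]).  For nu = 1 the weights are w = (1, 0, 0, ...)
and the same computation applies.

The functional equation of Gamma is obtained by integrating by parts on the
segments [1/N, N]: the boundary terms tend to 0 and the integrals converge
monotonically to those over the half-line ([gamma_integralS]).  This is done
with extended real integrals, where the limits always exist. *)

(** * Euler's integral and its functional equation *)

Definition gamma_integrand {R : realType} (x u : R) : R :=
  u `^ (x - 1) * expR (- u).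

Lemma gamma_integrand_ge0 {R : realType} (x u : R) : 0 <= gamma_integrand x u.
Proof. by rewrite mulr_ge0 ?powR_ge0 ?expR_ge0. Qed.

Lemma continuous_powR {R : realType} (x u : R) : 0 < u ->
  {for u, continuous (@powR R ^~ x)}.
Proof.
move=> u0; apply/differentiable_continuous/derivable1_diffP.
by apply: derivable_powR; rewrite in_itv/= u0.
Qed.

Lemma continuous_expRN {R : realType} : continuous (fun u : R => expR (- u)).
Proof.
move=> u; apply: (@continuous_comp _ _ _ (fun u : R => - u) expR).
  exact: opp_continuous.
exact: continuous_expR.
Qed.

Lemma continuous_gamma_integrand {R : realType} (x u : R) : 0 < u ->
  {for u, continuous (gamma_integrand x)}.
Proof.
move=> u0; apply: (@cvgM _ _ _ _ (@powR R ^~ (x - 1)) (fun u => expR (- u))).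
  exact: continuous_powR.
exact: continuous_expRN.
Qed.

(** One term of the exponential series of degree above x already dominates the
power: with n + 1 >= x, N ^ x <= N ^ (n + 1) <= (n + 2)! e ^ N / N. *)
Lemma cvg_powR_expRN {R : realType} (x : R) :
  k.+2%:R `^ x * expR (- k.+2%:R) @[k --> \oo] --> (0 : R).
Proof.
set n := Num.truncn x.
have lexn : x <= n.+1%:R by rewrite ltW// truncnS_gt.
apply: (@squeeze_cvgr _ _ _ _ (fun=> 0) (fun k => (n.+2)`!%:R * k.+1%:R^-1)).
- near=> k; rewrite mulr_ge0 ?powR_ge0 ?expR_ge0//=.
  have k2 : (0 : R) < k.+2%:R by rewrite ltr0n.
  apply: (@le_trans _ _ (k.+2%:R ^+ n.+1 * expR (- k.+2%:R))).
    rewrite ler_wpM2r ?expR_ge0// -powR_mulrn ?ler0n//.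
    by rewrite ler_powR// ler1n.
  rewrite expRN ler_pdivrMr ?expR_gt0//.
  apply: (@le_trans _ _ ((n.+2)`!%:R * k.+2%:R^-1 * expR k.+2%:R)); last first.
    rewrite ler_wpM2r ?expR_ge0// ler_wpM2l ?ler0n//.
    by rewrite lef_pV2 ?posrE ?ltr0n// ler_nat.
  have f0 : (0 : R) < (n.+2)`!%:R by rewrite ltr0n fact_gt0.
  have H : k.+2%:R ^+ n.+2 / (n.+2)`!%:R <= expR k.+2%:R :> R.
    by apply: le_trans (expR_ge1Dxn n.+1 (ltW k2)); rewrite lerDr.
  have := ler_wpM2l (ltW (divr_gt0 f0 k2)) H; apply: le_trans.
  rewrite [X in _ <= _ * (X / _)]exprS.
  rewrite le_eqVlt; apply/orP; left; apply/eqP.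
  by field; rewrite gt_eqF// -natrD pnatr_eq0.
- exact: cvg_cst.
- rewrite -[X in _ --> X](mulr0 ((n.+2)`!%:R)); apply: cvgMr.
  exact: cvg_harmonic.
Unshelve. all: by end_near. Qed.

(** An exhaustion of ]0, +oo[; the first segment is [1/2, 2] because
integration by parts needs distinct endpoints. *)
Definition itv_invn (R : realType) (k : nat) : set R :=
  `[k.+2%:R^-1, k.+2%:R]%classic.

Lemma bigcup_itv_invn (R : realType) :
  \bigcup_k itv_invn R k = `]0, +oo[%classic :> set R.
Proof.
rewrite /itv_invn; apply/seteqP; split => u /=.
  move=> [k _] /=; rewrite !in_itv/= andbT => /andP[+ _].
  by apply: lt_le_trans; rewrite invr_gt0 ltr0n.
rewrite in_itv/= andbT => u0.
exists (maxn (Num.truncn u) (Num.truncn u^-1)) => //=.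
rewrite in_itv/=; apply/andP; split.
  rewrite -[leRHS]invrK lef_pV2 ?posrE ?ltr0n ?invr_gt0//.
  rewrite ltW//; apply: lt_le_trans (truncnS_gt _) _.
  by rewrite ler_nat ltnW// !ltnS leq_maxr.
rewrite ltW//; apply: lt_le_trans (truncnS_gt _) _.
by rewrite ler_nat ltnW// !ltnS leq_maxl.
Qed.

Lemma cvg_integral_itv_invn (R : realType) (f : R -> R) :
  (forall u, 0 < u -> 0 <= f u) ->
  (forall u, 0 < u -> {for u, continuous f}) ->
  (\int[lebesgue_measure]_(u in itv_invn R k) (f u)%:E)%E
    @[k --> \oo] -->
  (\int[lebesgue_measure]_(u in `]0%R, +oo[) (f u)%:E)%E.
Proof.
move=> f0 cf.
have mf : measurable_fun `](0 : R), +oo[ f.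
  apply: open_continuous_measurable_fun.
    exact: interval_open.
  by move=> u; rewrite inE/= in_itv/= andbT; exact: cf.
rewrite -(bigcup_itv_invn R).
apply: ge0_nondecreasing_set_cvg_integral => //.
- apply/nondecreasing_seqP => k; rewrite subsetEset; apply: subset_itv.
    by rewrite bnd_simp lef_pV2 ?posrE ?ltr0n// ler_nat.
  by rewrite bnd_simp ler_nat.
- by move=> k; exact: measurable_itv.
- move=> k; apply/measurable_EFinP.
  refine (measurable_funS _ _ mf); first exact: measurable_itv.
  by rewrite -bigcup_itv_invn; exact: bigcup_sup.
- move=> k u; rewrite /itv_invn/= in_itv/= lee_fin => /andP[ku _]; apply: f0.
  by apply: lt_le_trans ku; rewrite invr_gt0 ltr0n.
Qed.

(** Stated on a segment away from 0, where the powers are differentiable even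
when x < 1 and the integrand of Gamma x is unbounded near 0. *)
Lemma gamma_integrand_by_parts {R : realType} (x a b : R) : 0 < a -> a < b ->
  (\int[lebesgue_measure]_(u in `[a, b]) (gamma_integrand (x + 1) u)%:E =
   (a `^ x * expR (- a) - b `^ x * expR (- b))%:E +
   x%:E * \int[lebesgue_measure]_(u in `[a, b]) (gamma_integrand x u)%:E)%E.
Proof.
move=> a0 ab.
have pos u : u \in `[a, b] -> 0 < u.
  by rewrite in_itv/= => /andP[+ _]; exact: lt_le_trans.
have b0 : 0 < b by apply: lt_trans ab.
have cw (f : R -> R) : (forall u, 0 < u -> {for u, continuous f}) ->
    {within `[a, b], continuous f}.
  move=> cf; apply: continuous_in_subspaceT => u; rewrite inE/= => uab.
  exact/cf/pos.
have oo u : u \in `]a, b[ -> 0 < u.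
  by rewrite in_itv/= => /andP[+ _]; exact: lt_trans.
have cpow y u : 0 < u -> {for u, continuous (fun u => x * u `^ y)}.
  by move=> u0; apply: cvgM; [exact: cvg_cst|exact: continuous_powR].
have ipart : (\int[lebesgue_measure]_(u in `[a, b])
      ((x * u `^ (x - 1)) * - expR (- u))%:E =
    - (x%:E * \int[lebesgue_measure]_(u in `[a, b]) (gamma_integrand x u)%:E))%E.
  rewrite -mulNe -integralZl//; last first.
    apply: continuous_compact_integrable; first exact: segment_compact.
    apply: cw => u; exact: continuous_gamma_integrand.
  apply: eq_integral => u _.
  by rewrite -EFinM /gamma_integrand mulrN mulNr mulrA.
have dexp (u : R) : is_derive u 1 (fun u => - expR (- u)) (expR (- u)).
  by apply: is_derive_eq; rewrite mulrN1 opprK.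
transitivity (\int[lebesgue_measure]_(u in `[a, b]) (u `^ x * expR (- u))%:E)%E.
  by apply: eq_integral => u _; rewrite /gamma_integrand addrK.
rewrite (@integration_by_parts R (@powR R ^~ x) (fun u => - expR (- u))
  (fun u => x * u `^ (x - 1)) (fun u => expR (- u)) a b ab).
- by rewrite ipart oppeK; congr (_%:E + _)%E; ring.
- by apply: cw => u; exact: cpow.
- split => [u /oo u0||].
  + by apply: derivable_powR; rewrite in_itv/= u0.
  + by apply: cvg_at_right_filter; exact: continuous_powR.
  + by apply: cvg_at_left_filter; exact: continuous_powR.
- by move=> u /oo u0; rewrite powR_derive1// in_itv/= u0.
- by apply: cw => u _; exact: continuous_expRN.
- split => [u _||].
  + exact: ex_derive.
  + by apply: cvg_at_right_filter; apply: cvgN; exact: continuous_expRN.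
  + by apply: cvg_at_left_filter; apply: cvgN; exact: continuous_expRN.
- by move=> u _; rewrite derive1E derive_val.
Qed.

(** Both sides are limits along the segments [1/N, N].  The boundary term at 1/N
vanishes because it is at most N ^ (- x) with x > 0, the one at N because of
the exponential. *)
Lemma gamma_integralS {R : realType} (x : R) : 0 < x ->
  (\int[lebesgue_measure]_(u in `]0%R, +oo[) (gamma_integrand (x + 1) u)%:E =
   x%:E * \int[lebesgue_measure]_(u in `]0%R, +oo[) (gamma_integrand x u)%:E)%E.
Proof.
move=> x0.
have cvgI y := @cvg_integral_itv_invn R (gamma_integrand y)
  (fun u _ => gamma_integrand_ge0 y u) (fun u => @continuous_gamma_integrand R y u).
apply: cvg_unique (cvgI (x + 1)) _ => //.
have -> : (fun k => \int[lebesgue_measure]_(u in itv_invn R k)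
    (gamma_integrand (x + 1) u)%:E)%E =
  (fun k => (k.+2%:R^-1 `^ x * expR (- k.+2%:R^-1) -
    k.+2%:R `^ x * expR (- k.+2%:R))%:E +
   x%:E * \int[lebesgue_measure]_(u in itv_invn R k) (gamma_integrand x u)%:E)%E.
  apply/funext => k; apply: gamma_integrand_by_parts.
    by rewrite invr_gt0 ltr0n.
  by apply: (@lt_trans _ _ 1); rewrite ?invf_lt1 ?ltr1n ?ltr0n.
rewrite -[(x%:E * _)%E]add0e; apply: cvgeD.
- exact: fin_num_adde_defr.
- apply/fine_cvgP; split; first by near=> k.
  rewrite -(subr0 0); apply: cvgB; last exact: cvg_powR_expRN.
  apply: (@squeeze_cvgr _ _ _ _ (fun=> 0) (fun k => k.+2%:R^-1 `^ x)).
  + near=> k; rewrite mulr_ge0 ?powR_ge0 ?expR_ge0//= ler_piMr ?powR_ge0//.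
  + exact: cvg_cst.
  + apply: (cvg_at_rightP _ _ _).1 (powR_cvg0 x0) _ _; split.
      by move=> k; rewrite invr_gt0 ltr0n.
    by have := @cvg_harmonic R; rewrite -cvg_shiftS.
- by apply: cvgeZl => //; exact: cvgI.
Unshelve. all: by end_near. Qed.

Lemma Gamma_gt0E {R : realType} (x : R) : 0 < x ->
  Gamma x = \int[lebesgue_measure]_(u in `]0, +oo[) gamma_integrand x u.
Proof.
move=> x0; rewrite /Gamma x0 big_ord0 divr1.
by under eq_Rintegral do rewrite addr0.
Qed.

Lemma Gamma_ge0 {R : realType} (x : R) : 0 < x -> 0 <= Gamma x.
Proof.
move=> x0; rewrite Gamma_gt0E//; apply: Rintegral_ge0 => u _.
exact: gamma_integrand_ge0.
Qed.

(** [Gamma] takes the real part of an extended integral, sending +oo to 0; the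
equation passes through this since x is positive. *)
Lemma GammaS {R : realType} (x : R) : 0 < x -> Gamma (x + 1) = x * Gamma x.
Proof.
move=> x0; rewrite !Gamma_gt0E ?addr_gt0// /Rintegral gamma_integralS//.
have : (0 <= \int[lebesgue_measure]_(u in `]0%R, +oo[) (gamma_integrand x u)%:E)%E.
  by apply: integral_ge0 => u _; rewrite lee_fin gamma_integrand_ge0.
case: (integral _ _ _) => [r _| _|//]; first by [].
by rewrite gt0_muley ?lte_fin//= mulr0.
Qed.

(** * The fractional difference as a convolution *)

(** For mu > 0 these are the coefficients of h ^ mu (1 - X) ^ (- mu); the value
at mu = 0 is what makes the sum of order 0 the identity. *)
Definition hsum_weight {R : realType} (h mu : R) (m : nat) : R :=
  if mu == 0 then (m == 0%N)%:R
  else h `^ mu * (Gamma (mu + m%:R) / (Gamma mu * Gamma (m%:R + 1))).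

Lemma hsum_weight_ge0 {R : realType} (h mu : R) (m : nat) : 0 <= mu ->
  0 <= hsum_weight h mu m.
Proof.
move=> mu0; rewrite /hsum_weight; case: eqP => [//|/eqP mun0].
have mu_gt0 : 0 < mu by rewrite lt0r mun0.
rewrite mulr_ge0 ?powR_ge0// divr_ge0//.
  by apply: Gamma_ge0; rewrite ltr_wpDr.
by rewrite mulr_ge0//; apply: Gamma_ge0; rewrite // ltr_wpDl.
Qed.

(** The functional equation gives w (m + 1) = (mu + m) / (m + 1) * w m, and the
ratio is at most 1 since mu <= 1. *)
Lemma hsum_weightS_le {R : realType} (h mu : R) (m : nat) : 0 <= mu <= 1 ->
  hsum_weight h mu m.+1 <= hsum_weight h mu m.
Proof.
move=> /andP[mu0 mu1].
have [mu00|mun0] := eqVneq mu 0; first by rewrite /hsum_weight mu00 eqxx ler0n.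
have mum_gt0 : 0 < mu + m%:R by rewrite ltr_wpDr// lt0r mun0.
have m1_gt0 : 0 < m%:R + 1 :> R by rewrite ltr_wpDl.
have -> : hsum_weight h mu m.+1 =
    (mu + m%:R) / (m%:R + 1) * hsum_weight h mu m.
  rewrite /hsum_weight (negbTE mun0) -!natr1 addrA.
  rewrite (GammaS _ mum_gt0) (GammaS _ m1_gt0).
  by rewrite !(invfM (Gamma mu)) (invfM (m%:R + 1)); ring.
rewrite ler_piMl ?hsum_weight_ge0// ler_pdivrMr// mul1r addrC lerD2l.
exact: mu1.
Qed.

(** The arguments that occur in the fractional sum: none of them meets a pole in
the denominator, so the h-factorial is a quotient of Gamma values. *)
Lemma hfact_node {R : realType} (h mu : R) (m : nat) : h != 0 ->
  hfact h ((mu + m%:R - 1) * h) (mu - 1) =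
  h `^ (mu - 1) * (Gamma (mu + m%:R) / Gamma (m%:R + 1)).
Proof.
move=> h0; rewrite /hfact mulfK// subrK.
have -> : mu + m%:R - (mu - 1) = m%:R + 1 by ring.
have /negbTE-> : ~~ Gamma_pole (m%:R + 1 : R); last by [].
rewrite /Gamma_pole; apply: contraTN isT => /natr_ge0.
by rewrite oppr_ge0 natr1 lern0.
Qed.

Lemma hsum_convolution {R : realType} (h a mu : R) (y : R -> R) (k : nat) :
  0 < h -> 0 <= mu ->
  hsum h a mu y (a + mu * h + k%:R * h) =
  \sum_(j < k.+1) hsum_weight h mu (k - j) * y (a + j%:R * h).
Proof.
move=> h_gt0 mu0; have hn0 := lt0r_neq0 h_gt0.
rewrite /hsum /hsum_weight; have [->|mun0] := eqVneq mu 0.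
  rewrite mul0r addr0 big_ord_recr/= subnn mul1r big1 ?add0r// => j _.
  by rewrite subn_eq0 leqNgt ltn_ord mul0r.
rewrite /rsum.
have -> : (a + mu * h + k%:R * h) / h - mu - a / h + 1 = k.+1%:R.
  by rewrite -natr1; field.
rewrite natrK mulr_sumr; apply: eq_bigr => j _.
have -> : (a / h + j%:R) * h = a + j%:R * h by field.
have -> : a + mu * h + k%:R * h - hsigma h (a + j%:R * h) =
    (mu + (k - j)%:R - 1) * h.
  by rewrite natrB ?leq_ord// /hsigma; ring.
rewrite hfact_node// (invfM (Gamma mu)).
have -> : h `^ mu = h * h `^ (mu - 1).
  by rewrite -[X in X * _](powRr1 (ltW h_gt0)) -powRD ?hn0 ?implybT// addrC subrK.
ring.
Qed.

(** Only the newest node enters with a positive coefficient; the coefficients of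
the older ones are the negated decrements of the weights. *)
Lemma rldiff_convolution {R : realType} (h a nu : R) (y : R -> R) (k : nat) :
  0 < h -> nu <= 1 ->
  let w := hsum_weight h (1 - nu) in
  rldiff h a nu y (a + (1 - nu) * h + k%:R * h) =
  h^-1 * (w 0%N * y (a + k.+1%:R * h) -
     \sum_(j < k.+1) (w (k - j)%N - w (k - j).+1) * y (a + j%:R * h)).
Proof.
move=> h_gt0 nu1 w; rewrite /rldiff /hdiff.
have -> : a + (1 - nu) * h + k%:R * h + h = a + (1 - nu) * h + k.+1%:R * h.
  by rewrite -natr1; ring.
rewrite !hsum_convolution ?subr_ge0// mulrC; congr (_ * _).
rewrite big_ord_recr/= subnn addrAC addrC; congr (_ + _).
rewrite -opprB -sumrB; congr (- _); apply: eq_bigr => j _.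
by rewrite mulrBl subSn ?leq_ord.
Qed.

(** * The quadratic form inequality *)

Lemma posdefmx_ge0 {R : realType} (n : nat) (P : 'M[R]_n) (x : 'cV[R]_n) :
  posdefmx P -> 0 <= (x^T *m P *m x) 0 0.
Proof.
move=> Ppos; have [->|x0] := eqVneq x 0; first by rewrite mulmx0 mxE.
exact/ltW/Ppos.
Qed.

Lemma quad_formB {R : realType} (n : nat) (P : 'M[R]_n) (x y : 'cV[R]_n) :
  P \is symmetricmx ->
  ((x - y)^T *m P *m (x - y)) 0 0 =
  (x^T *m P *m x) 0 0 - 2 * (x^T *m P *m y) 0 0 + (y^T *m P *m y) 0 0.
Proof.
move=> Psym.
have PT : P^T = P.
  by move/is_hermitianmxP: Psym; rewrite expr0 scale1r map_mx_id.
have -> : (x - y)^T *m P *m (x - y) =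
   x^T *m P *m x - x^T *m P *m y - (y^T *m P *m x - y^T *m P *m y).
  by rewrite [(x - y)^T]linearB/= !mulmxBl !mulmxBr.
have yx : y^T *m P *m x = (x^T *m P *m y)^T.
  by rewrite !trmx_mul trmxK PT mulmxA.
rewrite yx !mxE; ring.
Qed.

(** Twice the difference of the two sides is
[\sum_j d_j q (Y - z_j) + w (k + 1) q (Y)] with d_j = w (k - j) - w (k - j + 1):
complete the squares, and use that the d_j telescope to w 0 - w (k + 1). *)
Lemma quad_form_convolution_le {R : realType} (n k : nat) (P : 'M[R]_n)
    (w : nat -> R) (z : nat -> 'cV[R]_n) (Y : 'cV[R]_n) :
  P \is symmetricmx -> posdefmx P ->
  (forall m, 0 <= w m) -> (forall m, w m.+1 <= w m) ->
  2^-1 * (w 0%N * (Y^T *m P *m Y) 0 0 -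
     \sum_(j < k.+1) (w (k - j)%N - w (k - j).+1) * ((z j)^T *m P *m z j) 0 0)
  <= w 0%N * (Y^T *m P *m Y) 0 0 -
     \sum_(j < k.+1) (w (k - j)%N - w (k - j).+1) * (Y^T *m P *m z j) 0 0.
Proof.
move=> Psym Ppos w0 wS.
pose d (j : 'I_k.+1) := w (k - j)%N - w (k - j).+1.
have d0 j : 0 <= d j by rewrite subr_ge0.
have sumd : \sum_j d j = w 0%N - w k.+1.
  (* reversing the order of summation turns the d_j into consecutive decrements *)
  rewrite (reindex_inj rev_ord_inj)/=.
  rewrite (eq_bigr (fun j : 'I_k.+1 => w j - w j.+1)).
    rewrite -(big_mkord xpredT (fun j => w j - w j.+1))
      (@telescope_sumr_eq _ _ _ (fun j => - w j))//.
      by rewrite opprK addrC.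
    by move=> j _; rewrite opprK addrC.
  by move=> j _; rewrite /d/= subSS subKn// leq_ord.
have H : 0 <= \sum_j d j * ((Y - z j)^T *m P *m (Y - z j)) 0 0.
  by apply: sumr_ge0 => j _; rewrite mulr_ge0// posdefmx_ge0.
have HY : 0 <= w k.+1 * (Y^T *m P *m Y) 0 0.
  by rewrite mulr_ge0// posdefmx_ge0.
have E : \sum_j d j * ((Y - z j)^T *m P *m (Y - z j)) 0 0 =
   (w 0%N - w k.+1) * (Y^T *m P *m Y) 0 0
   - 2 * (\sum_j d j * (Y^T *m P *m z j) 0 0)
   + \sum_j d j * ((z j)^T *m P *m z j) 0 0.
  rewrite -sumd mulr_suml mulr_sumr -sumrB -big_split/=.
  by apply: eq_bigr => j _; rewrite quad_formB//; ring.
rewrite -/d in H *; rewrite E in H.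
lra.
Qed.

Theorem proposition3p16 (R : realType) (h a nu : R) (n : nat)
    (y : R -> 'cV[R]_n) (P : 'M[R]_n)
    (h_gt0 : 0 < h) (nu_gt0 : 0 < nu) (nu_le1 : nu <= 1)
    (P_sym : P \is symmetricmx) (P_posdef : posdefmx P)
    (t : R) (ht : hN h (a + (1 - nu) * h) t) :
  2^-1 * rldiff h a nu (fun s => ((y s)^T *m P *m y s) 0 0) t
  <= ((y (t + nu * h))^T *m P *m rldiffv h a nu y t) 0 0.
Proof.
case: ht => k ->; set w := hsum_weight h (1 - nu).
have -> : a + (1 - nu) * h + k%:R * h + nu * h = a + k.+1%:R * h.
  by rewrite -natr1; ring.
have -> : rldiffv h a nu y (a + (1 - nu) * h + k%:R * h) =
    h^-1 *: (w 0%N *: y (a + k.+1%:R * h) -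
     \sum_(j < k.+1) (w (k - j)%N - w (k - j).+1) *: y (a + j%:R * h)).
  apply/matrixP => i c; rewrite ord1 !mxE rldiff_convolution// summxE.
  by congr (_ * (_ - _)); apply: eq_bigr => j _; rewrite mxE.
rewrite rldiff_convolution// -scalemxAr [leRHS]mxE [leLHS]mulrCA ler_pM2l ?invr_gt0//.
rewrite mulmxBr -scalemxAr mulmx_sumr [leRHS]mxE.
rewrite [X in _ <= X + _]mxE [X in _ <= _ + X]mxE summxE.
under [X in _ <= _ - X]eq_bigr do rewrite -scalemxAr mxE.
apply: (@quad_form_convolution_le _ _ _ _ _ (fun j => y (a + j%:R * h))) => // m.
  by rewrite hsum_weight_ge0// subr_ge0.
by rewrite hsum_weightS_le// subr_ge0 nu_le1/= gerBl ltW.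
Qed.
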